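(* Let $T$ be a truss and let $M\xrightarrow{f}N\xrightarrow{g}P$ be a sequence of morphisms of heaps of $T$-modules. Suppose that the structures on $M$, $N$ and $P$ are induced by corresponding $\mathrm{R}(T)$-module structures $\mathcal{G}(M;o_M)$, $\mathcal{G}(N;o_N)$, $\mathcal{G}(P;o_P)$ (for some $o_M\in M$, $o_N\in N$, $o_P\in P$), and write $f=\alpha+h$, $g=\beta+k$, where $\alpha\colon\mathcal{G}(M;o_M)\to\mathcal{G}(N;o_N)$ and $\beta\colon\mathcal{G}(N;o_N)\to\mathcal{G}(P;o_P)$ are morphisms of $\mathrm{R}(T)$-modules, $h=f(o_M)\in N$ and $k=g(o_N)\in P$. Then $M\xrightarrow{f}N\xrightarrow{g}P$ is an exact sequence of heaps of $T$-modules if and only if $M\xrightarrow{\alpha}N\xrightarrow{\beta}P$ is an exact sequence of $\mathrm{R}(T)$-modules.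
   Context: An abelian heap is a (possibly empty) set $H$ with a ternary operation $[-,-,-]$ satisfying $[a,b,[c,d,e]]=[[a,b,c],d,e]$, $[a,b,b]=a=[b,b,a]$ and $[a,b,c]=[c,b,a]$; heap morphisms preserve the bracket. A truss is an abelian heap $T$ with an associative binary multiplication such that $t[s,s',s'']=[ts,ts',ts'']$ and $[s,s',s'']t=[st,s't,s''t]$ (not assumed unital). Every ring $R$ yields a truss $\mathrm{T}(R)$ with the same multiplication and bracket $[a,b,c]=a-b+c$. The universal ring $\mathrm{R}(T)$ is a (not necessarily unital) ring with a multiplicative heap morphism $\iota_T\colon T\to \mathrm{T}(\mathrm{R}(T))$ such that every multiplicative heap morphism $\varphi\colon T\to \mathrm{T}(R)$, $R$ a ring, factors as $\varphi=\hat\varphi\circ\iota_T$ for a unique ring homomorphism $\hat\varphi\colon \mathrm{R}(T)\to R$. A left $T$-module is an abelian heap $M$ with an action $\cdot\colon T\times M\to M$ with $t\cdot(t'\cdot m)=(tt')\cdot m$, $[t,t',t'']\cdot m=[t\cdot m,t'\cdot m,t''\cdot m]$, $t\cdot[m,n,e]=[t\cdot m,t\cdot n,t\cdot e]$. A heap of $T$-modules is an abelian heap $M$ (possibly empty) with an operation $T\times M\times M\to M$, $(t,m,n)\mapsto t\triangleright_m n$, such that for each $m\in M$ the map $(t,n)\mapsto t\triangleright_m n$ makes $M$ a left $T$-module, and $t\triangleright_m n=[t\triangleright_e n,t\triangleright_e m,m]$ for all $m,n,e\in M$, $t\in T$. Morphisms are heap morphisms $f$ with $f(t\triangleright_m n)=t\triangleright_{f(m)}f(n)$.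 A pointed $T$-module is an abelian group $G$ with a map $\cdot\colon T\times G\to G$ such that $t\cdot(t'\cdot g)=(tt')\cdot g$, $[t,t',t'']\cdot g=t\cdot g-t'\cdot g+t''\cdot g$ and $t\cdot(g+h)=t\cdot g+t\cdot h$; this is the same as a (not necessarily unital) $\mathrm{R}(T)$-module structure on $G$, via the universal property applied to $T\to \mathrm{T}(\mathrm{End}(G))$, and the morphisms (additive maps commuting with the action) coincide. For a non-empty heap of $T$-modules $(M,\triangleright)$ and $o\in M$, $\mathcal{G}(M;o)$ is the set $M$ with addition $x+y=[x,o,y]$ (zero $o$) and $T$-action $t\cdot x=t\triangleright_o x$; it is a pointed $T$-module, equivalently an $\mathrm{R}(T)$-module, and $(M,\triangleright)$ is recovered as $[x,y,z]=x-y+z$, $t\triangleright_x y=t\cdot y-t\cdot x+x$. The sums $\alpha+h$ and $\beta+k$ are taken in $\mathcal{G}(N;o_N)$ and $\mathcal{G}(P;o_P)$. A sequence $M\xrightarrow{f}N\xrightarrow{g}P$ of heaps of $T$-modules (with $P\neq\varnothing$) is exact if there exists $e\in g(N)$ such that $f(M)=g^{-1}(e)$. *)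

(* Defs.v *)
From HB Require Import structures.
From mathcomp Require Import all_boot all_order all_algebra.
From mathcomp Require Import boolp classical_sets functions.
Set Implicit Arguments.
Unset Strict Implicit.
Unset Printing Implicit Defensive.
Import GRing.Theory.
Local Open Scope classical_set_scope.
Local Open Scope ring_scope.

HB.mixin Record isAbelianHeap (H : Type) := {
  hbr : H -> H -> H -> H;
  hbrA : forall a b c d e, hbr a b (hbr c d e) = hbr (hbr a b c) d e;
  hbrKr : forall a b, hbr a b b = a;
  hbrKl : forall a b, hbr b b a = a;
  hbrC : forall a b c, hbr a b c = hbr c b a }.

#[short(type="heapType")]
HB.structure Definition AbelianHeap := {H of isAbelianHeap H}.

Notation "⟦ a , b , c ⟧" := (hbr a b c)
  (at level 0, a, b, c at level 99, format "⟦ a ,  b ,  c ⟧").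

Definition heap_morphism (H K : heapType) (f : H -> K) : Prop :=
  forall a b c, f ⟦a, b, c⟧ = ⟦f a, f b, f c⟧.

HB.mixin Record AbelianHeap_isTruss T of AbelianHeap T := {
  tmul : T -> T -> T;
  tmulA : forall r s t, tmul r (tmul s t) = tmul (tmul r s) t;
  tmul_hbrr : forall t a b c : T,
    tmul t ⟦a, b, c⟧ = ⟦tmul t a, tmul t b, tmul t c⟧;
  tmul_hbrl : forall a b c t : T,
    tmul ⟦a, b, c⟧ t = ⟦tmul a t, tmul b t, tmul c t⟧ }.

#[short(type="trussType")]
HB.structure Definition Truss := {T of AbelianHeap_isTruss T & AbelianHeap T}.

Definition truss_morphism (S T : trussType) (f : S -> T) : Prop :=
  heap_morphism f /\ forall s t, f (tmul s t) = tmul (f s) (f t).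

(* Rings, and modules over them, are not assumed unital. *)
HB.mixin Record Zmodule_isRng R of GRing.Zmodule R := {
  rmul : R -> R -> R;
  rmulA : forall x y z, rmul x (rmul y z) = rmul (rmul x y) z;
  rmulDl : forall x y z : R, rmul (x + y) z = rmul x z + rmul y z;
  rmulDr : forall x y z : R, rmul x (y + z) = rmul x y + rmul x z }.

#[short(type="rngType")]
HB.structure Definition Rng := {R of Zmodule_isRng R & GRing.Zmodule R}.

Definition rng_morphism (R S : rngType) (f : R -> S) : Prop :=
  {morph f : x y / x + y} /\ {morph f : x y / rmul x y}.

HB.mixin Record Zmodule_isRngModule (R : rngType) G of GRing.Zmodule G := {
  ract : R -> G -> G;
  ractA : forall r s g, ract (rmul r s) g = ract r (ract s g);
  ractDl : forall r s g, ract (r + s) g = ract r g + ract s g;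
  ractDr : forall r (g h : G), ract r (g + h) = ract r g + ract r h }.

#[short(type="rngModType")]
HB.structure Definition RngModule (R : rngType) :=
  {G of Zmodule_isRngModule R G & GRing.Zmodule G}.

Definition rngmod_morphism (R : rngType) (A B : rngModType R) (f : A -> B) :
    Prop :=
  {morph f : x y / x + y} /\ forall (r : R) x, f (ract r x) = ract r (f x).

(* The truss T(R), with bracket x - y + z. *)
Definition truss_of (R : rngType) : Type := R.

Section TrussOf.
Variable R : rngType.
Implicit Types x y z : R.

Let br x y z := x - y + z.

Let brA a b c d e : br a b (br c d e) = br (br a b c) d e.
Proof. by rewrite /br !addrA. Qed.

Let brKr a b : br a b b = a.
Proof. by rewrite /br subrK. Qed.

Let brKl a b : br b b a = a.
Proof. by rewrite /br subrr add0r. Qed.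

Let brC a b c : br a b c = br c b a.
Proof. by rewrite /br addrAC [RHS]addrAC (addrC a). Qed.

HB.instance Definition _ :=
  isAbelianHeap.Build (truss_of R) brA brKr brKl brC.

Lemma rmulN x y : rmul x (- y) = - rmul x y.
Proof.
apply/(addIr (rmul x y)); rewrite -rmulDr !addNr.
by apply/(addIr (rmul x 0)); rewrite -rmulDr !add0r.
Qed.

Lemma rmulNl x y : rmul (- x) y = - rmul x y.
Proof.
apply/(addIr (rmul x y)); rewrite -rmulDl !addNr.
by apply/(addIr (rmul 0 y)); rewrite -rmulDl !add0r.
Qed.

Let mul_brr t a b c : rmul t (br a b c) = br (rmul t a) (rmul t b) (rmul t c).
Proof. by rewrite /br !rmulDr rmulN. Qed.

Let mul_brl a b c t : rmul (br a b c) t = br (rmul a t) (rmul b t) (rmul c t).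
Proof. by rewrite /br !rmulDl rmulNl. Qed.

HB.instance Definition _ :=
  AbelianHeap_isTruss.Build (truss_of R) (@rmulA R) mul_brr mul_brl.
End TrussOf.

(* The universal ring R(T) is presented by generators [t], t in T, and the
   relations [⟦a, b, c⟧] = [a] - [b] + [c] and [a b] = [a] [b]; its universal
   property is [univ_ringP]. *)
Inductive rterm (T : Type) : Type :=
| Rgen of T
| Rzero
| Ropp of rterm T
| Radd of rterm T & rterm T
| Rmul of rterm T & rterm T.
Arguments Rzero {T}.

HB.instance Definition _ (T : Type) := gen_eqMixin (rterm T).
HB.instance Definition _ (T : Type) := gen_choiceMixin (rterm T).

Inductive rterm_eq (T : trussType) : rterm T -> rterm T -> Prop :=
| Req_refl x : rterm_eq x x
| Req_sym x y : rterm_eq x y -> rterm_eq y x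
| Req_trans y x z : rterm_eq x y -> rterm_eq y z -> rterm_eq x z
| Req_opp x x' : rterm_eq x x' -> rterm_eq (Ropp x) (Ropp x')
| Req_add x x' y y' :
    rterm_eq x x' -> rterm_eq y y' -> rterm_eq (Radd x y) (Radd x' y')
| Req_mul x x' y y' :
    rterm_eq x x' -> rterm_eq y y' -> rterm_eq (Rmul x y) (Rmul x' y')
| Req_addA x y z : rterm_eq (Radd x (Radd y z)) (Radd (Radd x y) z)
| Req_addC x y : rterm_eq (Radd x y) (Radd y x)
| Req_add0 x : rterm_eq (Radd Rzero x) x
| Req_addN x : rterm_eq (Radd (Ropp x) x) Rzero
| Req_mulA x y z : rterm_eq (Rmul x (Rmul y z)) (Rmul (Rmul x y) z)
| Req_mulDl x y z : rterm_eq (Rmul (Radd x y) z) (Radd (Rmul x z) (Rmul y z))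
| Req_mulDr x y z : rterm_eq (Rmul x (Radd y z)) (Radd (Rmul x y) (Rmul x z))
| Req_gen_hbr a b c :
    rterm_eq (Rgen ⟦a, b, c⟧) (Radd (Radd (Rgen a) (Ropp (Rgen b))) (Rgen c))
| Req_gen_mul a b : rterm_eq (Rgen (tmul a b)) (Rmul (Rgen a) (Rgen b)).

Section UniversalRing.
Variable T : trussType.
Implicit Types x y z : rterm T.

Definition rterm_eqb : rel (rterm T) := fun x y => `[< rterm_eq x y >].

Let eqb_refl : reflexive rterm_eqb.
Proof. by move=> x; apply/asboolP; apply: Req_refl. Qed.

Let eqb_sym : symmetric rterm_eqb.
Proof. by move=> x y; apply/asboolP/asboolP; apply: Req_sym. Qed.

Let eqb_trans : transitive rterm_eqb.
Proof. by move=> y x z /asboolP + /asboolP; rewrite /rterm_eqb => h1 h2;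
  apply/asboolP; apply: Req_trans h1 h2. Qed.

Canonical rterm_equiv := EquivRel rterm_eqb eqb_refl eqb_sym eqb_trans.

Definition univ_ring : Type := {eq_quot rterm_equiv}%qT.

HB.instance Definition _ := Choice.on univ_ring.
HB.instance Definition _ := EqQuotient.on univ_ring.

Definition upi (x : rterm T) : univ_ring := (\pi_univ_ring x)%qT.

Lemma upiP x y : upi x = upi y <-> rterm_eq x y.
Proof.
split; first by move=> /eqmodP/asboolP.
by move=> xy; apply/eqmodP/asboolP.
Qed.

Lemma repr_upi x : rterm_eq (repr (upi x)) x.
Proof. by apply/upiP; rewrite /upi reprK. Qed.

Lemma univ_ring_ind (Q : univ_ring -> Prop) :
  (forall x, Q (upi x)) -> forall u, Q u.
Proof. by move=> Qpi u; rewrite -[u]reprK; apply: Qpi. Qed.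

Let u0 : univ_ring := upi Rzero.
Let uopp (u : univ_ring) : univ_ring := upi (Ropp (repr u)).
Let uadd (u v : univ_ring) : univ_ring := upi (Radd (repr u) (repr v)).
Let umul (u v : univ_ring) : univ_ring := upi (Rmul (repr u) (repr v)).

Let uopp_pi x : uopp (upi x) = upi (Ropp x).
Proof. by apply/upiP/Req_opp/repr_upi. Qed.
Let uadd_pi x y : uadd (upi x) (upi y) = upi (Radd x y).
Proof. by apply/upiP/Req_add; apply: repr_upi. Qed.
Let umul_pi x y : umul (upi x) (upi y) = upi (Rmul x y).
Proof. by apply/upiP/Req_mul; apply: repr_upi. Qed.

Let uaddA : associative uadd.
Proof.
elim/univ_ring_ind=> x; elim/univ_ring_ind=> y; elim/univ_ring_ind=> z.
by rewrite !uadd_pi; apply/upiP/Req_addA.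
Qed.
Let uaddC : commutative uadd.
Proof.
elim/univ_ring_ind=> x; elim/univ_ring_ind=> y.
by rewrite !uadd_pi; apply/upiP/Req_addC.
Qed.
Let uadd0 : left_id u0 uadd.
Proof. by elim/univ_ring_ind=> x; rewrite uadd_pi; apply/upiP/Req_add0. Qed.
Let uaddN : left_inverse u0 uopp uadd.
Proof.
by elim/univ_ring_ind=> x; rewrite uopp_pi uadd_pi; apply/upiP/Req_addN.
Qed.

HB.instance Definition _ :=
  GRing.isZmodule.Build univ_ring uaddA uaddC uadd0 uaddN.

Let umulA u v w : umul u (umul v w) = umul (umul u v) w.
Proof.
elim/univ_ring_ind: u => x; elim/univ_ring_ind: v => y.
elim/univ_ring_ind: w => z.
by rewrite !umul_pi; apply/upiP/Req_mulA.
Qed.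
Let umulDl u v w : umul (u + v) w = umul u w + umul v w.
Proof.
elim/univ_ring_ind: u => x; elim/univ_ring_ind: v => y.
elim/univ_ring_ind: w => z.
rewrite -[_ + _]/(uadd _ _) -[RHS]/(uadd _ _).
by rewrite !(umul_pi, uadd_pi); apply/upiP/Req_mulDl.
Qed.
Let umulDr u v w : umul u (v + w) = umul u v + umul u w.
Proof.
elim/univ_ring_ind: u => x; elim/univ_ring_ind: v => y.
elim/univ_ring_ind: w => z.
rewrite -[_ + _]/(uadd _ _) -[RHS]/(uadd _ _).
by rewrite !(umul_pi, uadd_pi); apply/upiP/Req_mulDr.
Qed.

HB.instance Definition _ :=
  Zmodule_isRng.Build univ_ring umulA umulDl umulDr.

Lemma upi0 : upi Rzero = 0. Proof. by []. Qed.
Lemma upiN x : upi (Ropp x) = - upi x. Proof. exact/esym/uopp_pi. Qed.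
Lemma upiD x y : upi (Radd x y) = upi x + upi y.
Proof. exact/esym/uadd_pi. Qed.
Lemma upiM x y : upi (Rmul x y) = rmul (upi x) (upi y).
Proof. exact/esym/umul_pi. Qed.

Definition uiota (t : T) : truss_of univ_ring := upi (Rgen t).

Lemma uiota_morphism : truss_morphism uiota.
Proof.
split=> [a b c|a b].
  rewrite -[RHS]/(upi _ - upi _ + upi _) -upiN -!upiD.
  exact/upiP/Req_gen_hbr.
by rewrite -[RHS]/(rmul (upi _) (upi _)) -upiM; apply/upiP/Req_gen_mul.
Qed.

Fixpoint reval (R : rngType) (phi : T -> R) x : R :=
  match x with
  | Rgen t => phi t
  | Rzero => 0
  | Ropp x => - reval phi x
  | Radd x y => reval phi x + reval phi y
  | Rmul x y => rmul (reval phi x) (reval phi y)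
  end.

Lemma reval_eq (R : rngType) (phi : T -> truss_of R) :
  truss_morphism phi -> forall x y, rterm_eq x y ->
  reval (R := R) phi x = reval (R := R) phi y.
Proof.
move=> [phi_hbr phi_mul] x y; elim => //=.
- by move=> {}y {}x z _ -> _ ->.
- by move=> {}x x' _ ->.
- by move=> {}x x' {}y y' _ -> _ ->.
- by move=> {}x x' {}y y' _ -> _ ->.
- by move=> *; rewrite addrA.
- by move=> *; rewrite addrC.
- by move=> *; rewrite add0r.
- by move=> *; rewrite addNr.
- by move=> *; rewrite rmulA.
- by move=> *; rewrite rmulDl.
- by move=> *; rewrite rmulDr.
Qed.

Definition ulift (R : rngType) (phi : T -> truss_of R) (u : univ_ring) : R :=
  reval (R := R) phi (repr u).

Lemma ulift_upi (R : rngType) (phi : T -> truss_of R) :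
  truss_morphism phi -> forall x, ulift phi (upi x) = reval (R := R) phi x.
Proof. by move=> phiP x; apply: reval_eq => //; apply: repr_upi. Qed.

Lemma ulift_morphism (R : rngType) (phi : T -> truss_of R) :
  truss_morphism phi -> rng_morphism (ulift phi).
Proof.
move=> phiP; split; elim/univ_ring_ind=> x; elim/univ_ring_ind=> y.
  by rewrite -upiD !ulift_upi.
by rewrite -upiM !ulift_upi.
Qed.

Lemma ulift_iota (R : rngType) (phi : T -> truss_of R) :
  truss_morphism phi -> forall t, ulift phi (uiota t) = phi t.
Proof. by move=> phiP t; rewrite ulift_upi. Qed.

Lemma ulift_unique (R : rngType) (phi : T -> truss_of R) (psi : univ_ring -> R) :
  rng_morphism psi -> (forall t, psi (uiota t) = phi t) -> psi = ulift phi.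
Proof.
move=> [psiD psiM] psi_iota; apply/funext=> u.
rewrite -[u in LHS]reprK -[(\pi_univ_ring (repr u))%qT]/(upi (repr u)) /ulift.
have psi0 : psi 0 = 0 by apply: (addIr (psi 0)); rewrite -psiD !add0r.
elim: (repr u) => [t||x IHx|x IHx y IHy|x IHx y IHy] /=.
- exact: psi_iota.
- exact: psi0.
- by rewrite upiN; apply: (addIr (psi (upi x))); rewrite -psiD addNr psi0 IHx addNr.
- by rewrite upiD psiD IHx IHy.
- by rewrite upiM psiM IHx IHy.
Qed.

Theorem univ_ringP :
  truss_morphism uiota /\
  forall (R : rngType) (phi : T -> truss_of R), truss_morphism phi ->
  exists! psi : univ_ring -> R,
    rng_morphism psi /\ forall t, psi (uiota t) = phi t.
Proof.
split=> [|R phi phiP]; first exact: uiota_morphism.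
exists (ulift phi); split.
  by split; [apply: ulift_morphism | apply: ulift_iota].
by move=> psi [psiP psi_iota]; apply/esym/ulift_unique.
Qed.
End UniversalRing.

Record endo (G : zmodType) := Endo {
  endo_fun :> G -> G;
  endoD : {morph endo_fun : x y / x + y} }.

HB.instance Definition _ (G : zmodType) := gen_eqMixin (endo G).
HB.instance Definition _ (G : zmodType) := gen_choiceMixin (endo G).

Section EndoRing.
Variable G : zmodType.
Implicit Types f g h : endo G.

Lemma endoP f g : f =1 g -> f = g.
Proof.
case: f g => [f fD] [g gD] /= /funext fg.
by case: _ / fg gD => gD; congr Endo; apply: Prop_irrelevance.
Qed.

Let endo0D : {morph (fun=> 0 : G) : x y / x + y : G}.
Proof. by move=> x y; rewrite addr0. Qed.
Let endo_oppD f : {morph (fun x => - f x) : x y / x + y}.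
Proof. by move=> x y; rewrite endoD opprD. Qed.
Let endo_addD f g : {morph (fun x => f x + g x) : x y / x + y}.
Proof. by move=> x y; rewrite !endoD addrACA. Qed.
Let endo_mulD f g : {morph (fun x => f (g x)) : x y / x + y}.
Proof. by move=> x y; rewrite !endoD. Qed.

Definition endo0 : endo G := Endo endo0D.
Definition endo_opp f : endo G := Endo (endo_oppD f).
Definition endo_add f g : endo G := Endo (endo_addD f g).
Definition endo_mul f g : endo G := Endo (endo_mulD f g).

Let eaddA : associative endo_add.
Proof. by move=> f g h; apply: endoP => x /=; rewrite addrA. Qed.
Let eaddC : commutative endo_add.
Proof. by move=> f g; apply: endoP => x /=; rewrite addrC. Qed.
Let eadd0 : left_id endo0 endo_add.
Proof. by move=> f; apply: endoP => x /=; rewrite add0r. Qed.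
Let eaddN : left_inverse endo0 endo_opp endo_add.
Proof. by move=> f; apply: endoP => x /=; rewrite addNr. Qed.

HB.instance Definition _ :=
  GRing.isZmodule.Build (endo G) eaddA eaddC eadd0 eaddN.

Let emulA f g h : endo_mul f (endo_mul g h) = endo_mul (endo_mul f g) h.
Proof. exact: endoP. Qed.
Let emulDl f g h : endo_mul (f + g) h = endo_mul f h + endo_mul g h.
Proof. exact: endoP. Qed.
Let emulDr f g h : endo_mul f (g + h) = endo_mul f g + endo_mul f h.
Proof. by apply: endoP => x /=; rewrite endoD. Qed.

HB.instance Definition _ := Zmodule_isRng.Build (endo G) emulA emulDl emulDr.
End EndoRing.

HB.mixin Record Zmodule_isPointedModule (T : trussType) G of GRing.Zmodule G :=
{ pact : T -> G -> G;
  pactA : forall s t g, pact s (pact t g) = pact (tmul s t) g;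
  pact_hbr : forall a b c g, pact ⟦a, b, c⟧ g = pact a g - pact b g + pact c g;
  pactD : forall t (g h : G), pact t (g + h) = pact t g + pact t h }.

#[short(type="pointedModType")]
HB.structure Definition PointedModule (T : trussType) :=
  {G of Zmodule_isPointedModule T G & GRing.Zmodule G}.

Section PointedModuleAction.
Variables (T : trussType) (G : pointedModType T).

Definition pact_endo (t : T) : truss_of (endo G) :=
  @Endo G (pact t) (fun g h => pactD t g h).

Lemma pact_endo_morphism : truss_morphism pact_endo.
Proof.
split=> [a b c|a b]; apply: endoP => g /=; first exact: pact_hbr.
by rewrite pactA.
Qed.

(* The R(T)-module structure on a pointed T-module, obtained by extending
   T -> T(End(G)) to R(T). *)
Definition univ_act (r : univ_ring T) (g : G) : G := ulift pact_endo r g.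

Lemma univ_act_iota t g : univ_act (uiota t) g = pact t g.
Proof. by rewrite /univ_act (ulift_iota pact_endo_morphism). Qed.

Lemma univ_actA r s g : univ_act (rmul r s) g = univ_act r (univ_act s g).
Proof. by rewrite /univ_act (ulift_morphism pact_endo_morphism).2. Qed.

Lemma univ_actDl r s g : univ_act (r + s) g = univ_act r g + univ_act s g.
Proof. by rewrite /univ_act (ulift_morphism pact_endo_morphism).1. Qed.

Lemma univ_actDr r g h : univ_act r (g + h) = univ_act r g + univ_act r h.
Proof. exact: endoD. Qed.

Lemma univ_act_unique (act : univ_ring T -> G -> G) :
  (forall r s g, act (rmul r s) g = act r (act s g)) ->
  (forall r s g, act (r + s) g = act r g + act s g) ->
  (forall r g h, act r (g + h) = act r g + act r h) ->
  (forall t g, act (uiota t) g = pact t g) -> act = univ_act.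
Proof.
move=> actA actDl actDr act_iota.
pose psi (r : univ_ring T) : endo G := @Endo G (act r) (fun g h => actDr r g h).
have psi_morph : rng_morphism psi.
  by split=> r s; apply: endoP => g /=; [apply: actDl | apply: actA].
have psi_iota t : psi (uiota t) = pact_endo t.
  by apply: endoP => g; apply: act_iota.
have /(congr1 (fun F => F _)) psiE := ulift_unique psi_morph psi_iota.
by apply/funext=> r; apply/funext=> g; rewrite /univ_act -psiE.
Qed.
End PointedModuleAction.

Definition left_module_action (T : trussType) (M : heapType)
    (act : T -> M -> M) : Prop :=
  [/\ forall s t m, act s (act t m) = act (tmul s t) m,
      forall a b c m, act ⟦a, b, c⟧ m = ⟦act a m, act b m, act c m⟧
    & forall t m n e, act t ⟦m, n, e⟧ = ⟦act t m, act t n, act t e⟧].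

(* [tri m t n] is the element written t ▷_m n on paper. *)
HB.mixin Record AbelianHeap_isHeapOfModules (T : trussType) M
    of AbelianHeap M := {
  tri : M -> T -> M -> M;
  tri_module : forall m : M, left_module_action (tri m);
  tri_base : forall (t : T) (m n e : M),
    tri m t n = ⟦tri e t n, tri e t m, m⟧ }.

#[short(type="heapModType")]
HB.structure Definition HeapOfModules (T : trussType) :=
  {M of AbelianHeap_isHeapOfModules T M & AbelianHeap M}.

Definition heapmod_morphism (T : trussType) (M N : heapModType T)
    (f : M -> N) : Prop :=
  heap_morphism f /\ forall m (t : T) n, f (tri m t n) = tri (f m) t (f n).

(* G(M; o), as an abelian group, a pointed T-module and an R(T)-module. *)
Definition gmod (T : trussType) (M : heapModType T) (o : M) : Type := M.

HB.instance Definition _ T (M : heapModType T) (o : M) := gen_eqMixin (gmod o).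
HB.instance Definition _ T (M : heapModType T) (o : M) :=
  gen_choiceMixin (gmod o).

Section GModule.
Variables (T : trussType) (M : heapModType T) (o : M).
Implicit Types (x y z : M) (t : T).

Let add x y : M := ⟦x, o, y⟧.
Let opp x : M := ⟦o, x, o⟧.

Let gaddA : associative add. Proof. by move=> x y z; apply: hbrA. Qed.
Let gaddC : commutative add. Proof. by move=> x y; apply: hbrC. Qed.
Let gadd0 : left_id o add. Proof. by move=> x; apply: hbrKl. Qed.
Let gaddN : left_inverse o opp add.
Proof. by move=> x; rewrite /add /opp -hbrA hbrKl hbrKr. Qed.

HB.instance Definition _ :=
  GRing.isZmodule.Build (gmod o) gaddA gaddC gadd0 gaddN.

Lemma gmod0E : (0 : gmod o) = o. Proof. by []. Qed.

Lemma gmodDE (x y : gmod o) : x + y = ⟦x : M, o, y : M⟧. Proof. by []. Qed.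

Lemma gmod_hbr (x y z : gmod o) : x - y + z = ⟦x : M, y : M, z : M⟧.
Proof.
rewrite !gmodDE -[- y]/⟦o, y : M, o⟧.
by rewrite [⟦_, o, ⟦o, _, o⟧⟧]hbrA hbrKr -hbrA hbrKl.
Qed.

Lemma tri_id m t : tri m t m = m :> M.
Proof. by rewrite (tri_base t m m m) hbrKl. Qed.

Let gactA s t (g : gmod o) : tri o s (tri o t g) = tri o (tmul s t) g.
Proof. by have [+ _ _] := tri_module (s := M) o; apply. Qed.

Let gact_hbr a b c (g : gmod o) : tri o ⟦a, b, c⟧ g =
  (tri o a g : gmod o) - (tri o b g : gmod o) + (tri o c g : gmod o).
Proof. by rewrite gmod_hbr; have [_ + _] := tri_module (s := M) o; apply. Qed.

Let gactD t (g h : gmod o) :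
  tri o t (g + h : gmod o) = (tri o t g : gmod o) + (tri o t h : gmod o).
Proof.
by rewrite !gmodDE; have [_ _ ->] := tri_module (s := M) o; rewrite tri_id.
Qed.

HB.instance Definition _ := Zmodule_isPointedModule.Build T (gmod o)
  gactA gact_hbr gactD.

HB.instance Definition _ := Zmodule_isRngModule.Build (univ_ring T) (gmod o)
  (@univ_actA T (gmod o)) (@univ_actDl T (gmod o)) (@univ_actDr T (gmod o)).

(* M carries the structure of heap of T-modules induced by the R(T)-module
   G(M; o); by [univ_act_unique] this R(T)-action is the only one for which
   [gmod_act] holds. *)
Lemma gmod_act t (x : gmod o) : ract (uiota t : univ_ring T) x = tri o t x.
Proof. exact: univ_act_iota. Qed.

Lemma gmod_tri t (x y : gmod o) :
  tri (x : M) t (y : M) = ract (uiota t : univ_ring T) y - ract (uiota t : univ_ring T) x + x.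
Proof. by rewrite gmod_hbr !gmod_act -tri_base. Qed.
End GModule.

Notation "'𝒢(' M ; o )" := (@gmod _ M o) (at level 8, format "'𝒢(' M ;  o )").

(* The witness e makes P nonempty. *)
Definition heapmod_exact (T : trussType) (M N P : heapModType T)
    (f : M -> N) (g : N -> P) : Prop :=
  exists2 e : P, range g e & range f = g @^-1` [set e].

Definition rngmod_exact (R : rngType) (A B C : rngModType R)
    (alpha : A -> B) (beta : B -> C) : Prop :=
  range alpha = beta @^-1` [set 0].

(* Main.v *)
Require Import Defs.
From HB Require Import structures.
From mathcomp Require Import all_boot all_order all_algebra.
From mathcomp Require Import boolp classical_sets functions.
Import GRing.Theory.
Local Open Scope classical_set_scope.
Local Open Scope ring_scope.

(** Both exactness conditions compare subsets of N, and translation by h matches them: the range of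
    f is [range alpha] + h, and the fibre of g through h is the kernel of [beta] translated by h.
    Since h = f(o_M), the only possible witness [e] is g(h). *)

(* A translate of [range alpha] is a fibre of [beta + k] only if it is the fibre
   through [h = f 0], which is the translate of [ker beta] by [h]. *)
Lemma affine_exact (A B C : zmodType) (alpha f : A -> B) (beta g : B -> C)
    (h : B) (k : C) :
  alpha 0 = 0 -> {morph beta : x y / x + y} ->
  (forall x, f x = alpha x + h) -> (forall y, g y = beta y + k) ->
  (exists2 e, range g e & range f = g @^-1` [set e]) <->
  range alpha = beta @^-1` [set 0].
Proof.
move=> alpha0 betaD fE gE.
have range_fE y : range f (y + h) <-> range alpha y.
  split=> -[x _ xy]; exists x => //; last by rewrite fE xy.
  by apply: (addIr h); rewrite -fE.
have fiber_gE y : g (y + h) = g h <-> beta y = 0.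
  rewrite !gE betaD -addrA -[in X in _ = X](add0r (beta h + k)).
  by split=> [/addIr|->].
split=> [[e _ fg] | alpha_beta].
  (* As [alpha 0 = 0], the point [h] lies in the range of [f], which is the fibre over [e]. *)
  have eE : e = g h.
    have /range_fE : range alpha 0 by exists 0.
    by rewrite add0r fg => /= ->.
  rewrite eE in fg.
  apply/seteqP; split=> y.
    by move=> /range_fE; rewrite fg => /fiber_gE.
  by move=> /fiber_gE gy; apply/range_fE; rewrite fg.
exists (g h); first by exists h.
(* Writing [y] as [(y - h) + h] puts it in the form that both translation equivalences treat. *)
apply/seteqP; split=> y; rewrite -(subrK h y).
  by move=> /range_fE; rewrite alpha_beta => /fiber_gE.
by move=> /fiber_gE by0; apply/range_fE; rewrite alpha_beta.
Qed.

Theorem proposition5p5 (T : trussType) (M N P : heapModType T)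
  (f : M -> N) (g : N -> P)
  (f_morph : heapmod_morphism f) (g_morph : heapmod_morphism g)
  (oM : M) (oN : N) (oP : P)
  (alpha : 𝒢(M; oM) -> 𝒢(N; oN)) (beta : 𝒢(N; oN) -> 𝒢(P; oP))
  (alpha_morph : rngmod_morphism (R := univ_ring T) alpha)
  (beta_morph : rngmod_morphism (R := univ_ring T) beta)
  (h : 𝒢(N; oN)) (k : 𝒢(P; oP))
  (hE : h = f oM) (kE : k = g oN)
  (fE : forall x : 𝒢(M; oM), f x = alpha x + h)
  (gE : forall y : 𝒢(N; oN), g y = beta y + k) :
  heapmod_exact f g <-> rngmod_exact (R := univ_ring T) alpha beta.
Proof.
have alpha0 : alpha 0 = 0.
  by apply: (addIr (alpha 0)); rewrite -alpha_morph.1 !add0r.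
(* The carrier of [𝒢(M; o)] is M itself, so both notions of exactness unfold to the two sides of
   [affine_exact]. *)
exact (@affine_exact 𝒢(M; oM) 𝒢(N; oN) 𝒢(P; oP) alpha f beta g h k alpha0 beta_morph.1 fE gE).
Qed.
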